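(* Let $s^*\in(-\infty,0)\cup(0,1]$ and let $F$ be a bi-$s^*$-concave distribution function on $\mathbb{R}$. Define $$F_L(x)=\frac1{s^*}\big(F^{s^*}(x)-(1-s^* )\big),\qquad F_U(x)=\frac1{s^*}\big(1-(1-F(x))^{s^*}\big).$$ Then $F_L(x)\le F(x)\le F_U(x)$ for all $x$. Moreover, $F_U$ is a convex function on $J(F)$ and $F_L$ is a concave function on $J(F)$, where $J(F)=\{x\in\mathbb{R}:0<F(x)<1\}$. For $s^*=0$ and $F$ bi-$0$-concave (bi-log-concave), the inequalities $F_L(x)\le F(x)\le F_U(x)$ hold with $F_L(x)=1+\log F(x)$ and $F_U(x)=-\log(1-F(x))$.
   Context: For $s^*\in(-\infty,1]$, a distribution function $F$ on $\mathbb{R}$ is bi-$s^*$-concave if $F$ is continuous on $\mathbb{R}$ and, on $J(F)$: for $s^*<0$, both $F^{s^*}$ and $(1-F)^{s^*}$ are convex; for $s^*=0$, both $\log F$ and $\log(1-F)$ are concave; for $0<s^*\le 1$, both $F^{s^*}$ and $(1-F)^{s^*}$ are concave. Conventions: $0^{s^*}=\infty$ for $s^*<0$ and $\log 0=-\infty$, so $F_L$, $F_U$ may take the values $-\infty$, $+\infty$ respectively outside $J(F)$. *)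

(* Defs.v *)
From mathcomp Require Import all_boot all_order all_algebra.
From mathcomp Require Import all_classical all_reals all_analysis.

Set Implicit Arguments.
Unset Strict Implicit.
Unset Printing Implicit Defensive.

Import Order.TTheory GRing.Theory Num.Theory.
Import numFieldNormedType.Exports.

Local Open Scope classical_set_scope.
Local Open Scope ring_scope.

Definition J (R : realType) (F : R -> R) : set R := [set x | 0 < F x < 1].

Definition concave_function (R : realType) (D : set R) (f : R -> R) : Prop :=
  convex_function (D : set R^o) (fun x : R^o => - f x).

(* On J F both F and 1 - F are positive, so the real-valued powR and ln take
   their usual values there. *)
Definition bi_s_concave (R : realType) (s : R) (F : R -> R) : Prop :=
  [/\ continuous F,
      s < 0 -> convex_function (J F : set R^o) (fun x : R^o => F x `^ s) /\
               convex_function (J F : set R^o) (fun x : R^o => (1 - F x) `^ s),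
      s = 0 -> concave_function (J F) (fun x => ln (F x)) /\
               concave_function (J F) (fun x => ln (1 - F x)) &
      0 < s <= 1 -> concave_function (J F) (fun x => F x `^ s) /\
                    concave_function (J F) (fun x => (1 - F x) `^ s)].

(* powR sets 0 `^ s = 0 for every s != 0, whereas 0 ^ s = +oo is needed
   for s < 0. *)
Definition epow (R : realType) (y s : R) : \bar R :=
  if (y == 0) && (s < 0) then +oo%E else (y `^ s)%:E.

Definition F_L (R : realType) (s : R) (F : R -> R) (x : R) : \bar R :=
  ((s^-1)%:E * (epow (F x) s - (1 - s)%:E))%E.

Definition F_U (R : realType) (s : R) (F : R -> R) (x : R) : \bar R :=
  ((s^-1)%:E * (1 - epow (1 - F x) s))%E.

(* lne is extended-valued, with lne 0 = -oo. *)
Definition F_L0 (R : realType) (F : R -> R) (x : R) : \bar R :=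
  (1 + lne (F x)%:E)%E.

Definition F_U0 (R : realType) (F : R -> R) (x : R) : \bar R :=
  (- lne (1 - F x)%:E)%E.

(* Convexity and concavity on D of a function that may take infinite values
   outside D but must be real-valued on D. *)
Definition econvex_on (R : realType) (D : set R) (f : R -> \bar R) : Prop :=
  (forall x, D x -> f x \is a fin_num) /\
  convex_function (D : set R^o) (fun x : R^o => fine (f x)).

Definition econcave_on (R : realType) (D : set R) (f : R -> \bar R) : Prop :=
  (forall x, D x -> f x \is a fin_num) /\
  concave_function D (fun x => fine (f x)).

(* Main.v *)
(** Both bounds on [F] are the single inequality [(y^s - 1) / s <= y - 1] for
    [0 <= y] and [s <= 1], taken at [y = F x] and at [y = 1 - F x].  With
    [y = exp t] it reads [(exp (s t) - 1) / s <= exp t - 1]: for [s > 0] this is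
    convexity of [exp] between [0] and [t], and for [s < 0] it is
    [1 + s t <= exp (s t)] followed by [1 + t <= exp t].  On the interval [J F],
    [F_U] and [- F_L] are constants plus [- y^s / s], which is convex by
    bi-[s]-concavity. *)
Require Import Defs.
From mathcomp Require Import all_boot all_order all_algebra.
From mathcomp Require Import all_classical all_reals all_analysis.
From mathcomp Require Import ring lra.

Import Order.TTheory GRing.Theory Num.Theory.

Local Open Scope ring_scope.
Local Open Scope convex_scope.

Lemma powR_sub1_div_le (R : realType) (s y : R) :
  s <= 1 -> s != 0 -> 0 < y -> s^-1 * (y `^ s - 1) <= y - 1.
Proof.
move=> s1 s0 y0; rewrite /powR (gt_eqF y0) -[in leRHS](lnK (y0 : y \is Num.pos)).
set t := ln y.
have [sn|sp] : s < 0 \/ 0 < s by apply/orP; rewrite -neq_lt.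
  rewrite mulrC ler_ndivrMr//.
  have := expR_ge1Dx (s * t); have := expR_ge1Dx t; nra.
rewrite mulrC ler_pdivrMr//.
have s01 : Itv.spec (@Itv.num_sem R) (Itv.Real `[0%Z, 1%Z]) s.
  by rewrite /= /Itv.num_sem/= num_real in_itv/= s1 (ltW sp).
(* Weight [s] on [t] and [1 - s] on [0]: the intermediate point is [s * t]. *)
have := convex_expR (Itv.mk s01) t 0.
rewrite !convRE /= mulr0 addr0 expR0 mulr1 /unstable.onem; lra.
Qed.

(** What is new is [y = 0]: for [s < 0] the left side is [-oo], and for [0 < s <= 1] the claim
    becomes [1 <= s^-1]. *)
Lemma epow_sub1_div_le (R : realType) (s y : R) :
  s <= 1 -> s != 0 -> 0 <= y ->
  ((s^-1)%:E * (epow y s - 1) <= (y - 1)%:E)%E.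
Proof.
move=> s1 s0; rewrite le_eqVlt => /predU1P[<-|y0]; last first.
  by rewrite /epow (gt_eqF y0)/= lee_fin powR_sub1_div_le.
have [sn|sp] : s < 0 \/ 0 < s by apply/orP; rewrite -neq_lt.
  by rewrite /epow eqxx sn/= lt0_muley ?lte_fin ?invr_lt0// leNye.
rewrite /epow eqxx (lt_gtF sp)/= powR0// lee_fin !sub0r mulrN1 lerN2.
by rewrite invf_ge1.
Qed.

(** Counterpart for [s = 0], with [ln y] as the limit of [(y^s - 1) / s]. *)
Lemma lne_le_sub1 (R : realType) (y : R) : (lne y%:E <= (y - 1)%:E)%E.
Proof.
have [y0|y0] := leP y 0; first by rewrite le0_lneNy// leNye.
by rewrite lne_EFin// lee_fin -{1}(subrKC 1 y) le_ln1Dx//; lra.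
Qed.

Section distribution_function.
Context (R : realType) (F : cumulativeBounded (0 : R) (1 : R)).

Lemma cumulative01_ge0 x : 0 <= F x.
Proof.
apply: (cvgr_to_le (cumulativeNy F)); near=> y.
by apply: (cumulative_is_nondecreasing F); near: y; exact: nbhs_ninfty_le.
Unshelve. all: by end_near. Qed.

Lemma cumulative01_le1 x : F x <= 1.
Proof.
apply: (cvgr_to_ge (cumulativey F)); near=> y.
by apply: (cumulative_is_nondecreasing F); near: y; exact: nbhs_pinfty_ge.
Unshelve. all: by end_near. Qed.

(** By monotonicity, positivity passes from the left endpoint to any point between, and being below
    [1] passes from the right endpoint. *)
Lemma convex_set_J : convex_set (J F : set (convex_lmodType R^o)).
Proof.
move=> x y t; rewrite !inE.
wlog xy : x y t / x <= y => [wl|].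
  have [|/ltW yx Jx Jy] := leP x y; first exact: wl.
  by rewrite convC; apply: wl.
move=> /andP[Fx0 _] /andP[_ Fy1].
have : (x : R^o) <| t |> y \in `[x, y] by exact: (@convR_itv R x y t).
rewrite in_itv/= => /andP[xz zy]; apply/andP; split.
  exact: lt_le_trans Fx0 (cumulative_is_nondecreasing F _ _ xz).
exact: le_lt_trans (cumulative_is_nondecreasing F _ _ zy) Fy1.
Qed.

End distribution_function.

(** The closed forms of [F_L] and [F_U] are available only on [J F], so the equation is assumed on
    [D] alone; convexity of [D] makes it apply at the intermediate point. *)
Lemma convex_function_eq_add (R : realType) (D : set (convex_lmodType R^o))
    (f g : R -> R) (c : R) :
  convex_set D -> {in D, forall x, g x = f x + c} ->
  convex_function D (f : R^o -> R^o) -> convex_function D (g : R^o -> R^o).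
Proof.
move=> cD gE cf t x y xD yD; rewrite convRE !gE//; last exact: cD.
by have := cf t x y xD yD; rewrite convRE /unstable.onem; lra.
Qed.

Lemma convex_function_scale (R : realType) (D : set (convex_lmodType R^o))
    (f : R -> R) (a : R) :
  0 <= a -> convex_function D (f : R^o -> R^o) ->
  convex_function D ((fun x => a * f x) : R^o -> R^o).
Proof.
move=> a0 cf t x y xD yD.
have := ler_wpM2l a0 (cf t x y xD yD); rewrite !convRE /unstable.onem; lra.
Qed.

(** The sign of [s^-1] changes exactly where the hypothesis switches from convex to concave. *)
Lemma convex_opp_powR_div (R : realType) (D : set R^o) (h : R -> R) (s : R) :
  s <= 1 -> s != 0 ->
  (s < 0 -> convex_function (D : set R^o) (fun x : R^o => h x `^ s)) ->
  (0 < s <= 1 -> concave_function D (fun x => h x `^ s)) ->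
  convex_function (D : set R^o) (fun x : R^o => - (s^-1 * h x `^ s)).
Proof.
move=> s1 s0 cvx ccv.
have [sn|sp] : s < 0 \/ 0 < s by apply/orP; rewrite -neq_lt.
  rewrite (_ : (fun=> _) = (fun x => - s^-1 * h x `^ s)); last first.
    by apply/funext => x; rewrite mulNr.
  by apply: convex_function_scale (cvx sn); rewrite oppr_ge0 invr_le0 ltW.
rewrite (_ : (fun=> _) = (fun x => s^-1 * - (h x `^ s))); last first.
  by apply/funext => x; rewrite mulrN.
by apply: convex_function_scale; [rewrite invr_ge0 ltW | apply: ccv; rewrite sp].
Qed.

Theorem corollary5 (R : realType) :
  (forall (s : R) (F : cumulativeBounded (0 : R) (1 : R)),
     s <= 1 -> s != 0 -> bi_s_concave s F ->
     [/\ forall x : R, (F_L s F x <= (F x)%:E)%E /\ ((F x)%:E <= F_U s F x)%E,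
         econvex_on (J F) (F_U s F) &
         econcave_on (J F) (F_L s F)]) /\
  (forall F : cumulativeBounded (0 : R) (1 : R),
     bi_s_concave 0 F ->
     forall x : R, (F_L0 F x <= (F x)%:E)%E /\ ((F x)%:E <= F_U0 F x)%E).
Proof.
split=> [s F s1 s0 [_ cvx _ ccv]|F _ x]; last first.
  split.
    by have := leeD2l 1 (lne_le_sub1 _ (F x)); rewrite -EFinD subrKC.
  rewrite /F_U0 leeNr (le_trans (lne_le_sub1 _ _))// lee_fin; lra.
(* On [J F] the infinite branch of [epow] is excluded, so both bounds are real. *)
have ULE x : J F x ->
    F_L s F x = (s^-1 * F x `^ s + s^-1 * (s - 1))%:E /\
    F_U s F x = (- (s^-1 * (1 - F x) `^ s) + s^-1)%:E.
  move=> /andP[F0 F1]; have F1' : 0 < 1 - F x by rewrite subr_gt0.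
  rewrite /F_L /F_U /epow (gt_eqF F0) (gt_eqF F1')/=.
  by split; congr (_%:E); ring.
split.
- move=> x; split.
    have := epow_sub1_div_le _ _ _ s1 s0 (cumulative01_ge0 _ F x).
    rewrite /F_L /epow; case: ifPn => [/andP[_ sn] _|_].
      by rewrite /= lt0_muley ?lte_fin ?invr_lt0// leNye.
    rewrite /= !lee_fin; have := mulVf s0; nra.
  have F1 : 0 <= 1 - F x by rewrite subr_ge0 cumulative01_le1.
  have := epow_sub1_div_le _ _ _ s1 s0 F1.
  rewrite /F_U /epow; case: ifPn => [/andP[_ sn] _|_].
    by rewrite /= lt0_muleNy ?lte_fin ?invr_lt0// leey.
  rewrite /= !lee_fin; nra.
- split=> [x /ULE[_ ->]//|].
  apply: (@convex_function_eq_add _ _ (fun x => - (s^-1 * (1 - F x) `^ s)) _ s^-1).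
  + exact: convex_set_J.
  + by move=> x /set_mem/ULE[_ ->].
  + by apply: convex_opp_powR_div => // [/cvx[]|/ccv[]].
- split=> [x /ULE[-> _]//|].
  apply: (@convex_function_eq_add _ _ (fun x => - (s^-1 * F x `^ s)) _
            (- (s^-1 * (s - 1)))).
  + exact: convex_set_J.
  + by move=> x /set_mem/ULE[-> _]/=; rewrite opprD.
  + by apply: convex_opp_powR_div => // [/cvx[]|/ccv[]].
Qed.
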